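(* Let $q$ be a prime power, let $n\ge 2$ be an integer, and let $C=\{\mathcal A_1,\ldots,\mathcal A_n\}$ be a set of $\mathbb F_q$-affine hyperplanes of $\mathbb F_{q^n}$ in general position. Let $\mathcal S_C^*=\bigcap_{i=1}^n\left(\mathbb F_{q^n}\setminus \mathcal A_i\right)$. Then $\mathcal S_C^*$ contains a primitive element of $\mathbb F_{q^n}$ provided that one of the following holds: (i) $q\ge 16$; (ii) $q=13$ and $n\ne 4$; (iii) $q=11$ and $n\ne 4,6,12$; (iv) $q\in\{7,8,9\}$ and $n$ is large enough (i.e., for each such $q$ there is $N(q)$ such that the conclusion holds for all $n\ge N(q)$).
   Context: $\mathbb F_{q^n}$ is regarded as an $n$-dimensional vector space over $\mathbb F_q$. An $\mathbb F_q$-affine space of dimension $t$ in $\mathbb F_{q^n}$ is a set $u+V$ with $u\in\mathbb F_{q^n}$ and $V$ an $\mathbb F_q$-linear subspace of dimension $t$; an $\mathbb F_q$-affine hyperplane is one of dimension $n-1$. A set $C=\{\mathcal A_1,\ldots,\mathcal A_n\}$ of $\mathbb F_q$-affine hyperplanes is in general position if for each $1\le k\le n$ the intersection of any $k$ distinct elements of $C$ is an $\mathbb F_q$-affine space of dimension $n-k$. A primitive element of $\mathbb F_{q^n}$ is a generator of the cyclic group $\mathbb F_{q^n}^*$. *)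

(* Defs.v *)
From mathcomp Require Import all_boot all_fingroup all_algebra all_solvable all_field.

Set Implicit Arguments.
Unset Strict Implicit.
Unset Printing Implicit Defensive.

Import GRing.Theory.
Local Open Scope ring_scope.

Section AffineSpaces.
(* [finvect_type L] is L itself, equipped with its finite field structure, so
   that finite sets of elements of L can be formed. *)
Variables (F : finFieldType) (L : fieldExtType F).
Local Notation E := (finvect_type L).

Definition affine_space (t : nat) (A : {set E}) : Prop :=
  exists (u : E) (V : {vspace E}), \dim V = t /\ A = [set u + v | v in V].

Definition affine_hyperplane (A : {set E}) : Prop :=
  affine_space (\dim {: E}).-1 A.

(* Meant for a set C of n affine hyperplanes, where n = \dim {: E}; then
   k <= n below and the subtraction does not truncate. *)
Definition general_position (C : {set {set E}}) : Prop :=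
  forall D : {set {set E}}, D \subset C -> (1 <= #|D| <= \dim {: E})%N ->
    affine_space (\dim {: E} - #|D|) (\bigcap_(A in D) A).

Definition avoiding (C : {set {set E}}) : {set E} := \bigcap_(A in C) ~: A.

Definition primitive_element (x : E) : Prop :=
  exists2 u : {unit E}, FinRing.uval u = x & generator [set: {unit E}] u.

End AffineSpaces.

(* Main.v *)
(* Let m = q^n - 1 and let S be the set of elements avoiding all n hyperplanes;
   inclusion-exclusion gives |S| = (q - 1)^n. A primitive element of S exists
   as soon as one of two criteria holds.

   (1) phi(m) + (q - 1)^n > q^n, by counting.

   (2) 4^(omega(m) + n) <= q^n. The indicator of the complement of a coset of
   index k in a finite abelian group has Fourier coefficients whose absolute
   values sum to 2 (1 - 1/k), and this l^1 norm is submultiplicative. Hence the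
   indicator of S has norm at most (2 (1 - 1/q))^n over the additive group, and
   the indicator of the generators, a product over the primes p dividing m of
   indicators of complements of the subgroups of index p, has norm at most
   2^omega(m) phi(m)/m and mean phi(m)/m over the multiplicative group. The
   cross terms are Gauss sums, of absolute value at most q^(n/2).

   For B = 4^c one has B^omega(m) prod_(p < B) p <= B^pi(B) m, which yields (2)
   outside a finite set of pairs (q, n) when q >= 11, and for n large when
   q = 7, 8, 9 (with c = 4, because 4^4 < 7^3). For the remaining pairs one of
   the criteria is checked by trial division, an unfactored cofactor r with no
   prime divisor below B having at most log_B r prime divisors. *)
From Stdlib Require Import NArith.
Require Import Defs.
From mathcomp Require Import all_boot all_fingroup all_algebra all_solvable all_field.
From mathcomp Require Import all_order all_character zify.

Set Implicit Arguments.
Unset Strict Implicit.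
Unset Printing Implicit Defensive.

(** * Prime divisors and the two criteria *)

Definition primes_below B := [seq p <- iota 0 B | prime p].

Lemma prod_primes_below_gt0 B : 0 < \prod_(p <- primes_below B) p.
Proof.
rewrite big_seq prodn_cond_gt0 // => p.
by rewrite mem_filter => /andP[/prime_gt0].
Qed.

Lemma prod_primes_leq n : 0 < n -> \prod_(p <- primes n) p <= n.
Proof.
move=> n_gt0; rewrite {2}(prod_prime_decomp n_gt0) prime_decompE big_map /=.
rewrite big_seq [X in _ <= X]big_seq; apply: leq_prod => p p_n.
rewrite -{1}(expn1 p) leq_exp2l ?logn_gt0 // prime_gt1 //.
by move: p_n; rewrite mem_primes => /andP[].
Qed.

Section PrimeDivisors.
Variables (B m : nat).
Hypothesis m_gt0 : 0 < m.

Lemma big_primes_split (R : Type) (idx : R) (op : Monoid.com_law idx) (F : nat -> R) :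
  \big[op/idx]_(p <- primes m) F p =
  op (\big[op/idx]_(p <- primes_below B | p %| m) F p)
     (\big[op/idx]_(p <- primes m | B <= p) F p).
Proof.
rewrite (bigID [pred p | p < B]) /=; congr (op _ _); last first.
  by apply: eq_bigl => p; rewrite -leqNgt.
rewrite -big_filter -[RHS]big_filter; apply: perm_big; apply: uniq_perm.
- exact/filter_uniq/primes_uniq.
- exact/filter_uniq/filter_uniq/iota_uniq.
move=> p; rewrite !mem_filter mem_primes m_gt0 mem_iota add0n /=.
by case: (p < B); case: (prime p); rewrite ?andbF ?andbT.
Qed.

Lemma expn_size_primes a : a ^ size (primes m) = \prod_(p <- primes m) a.
Proof. by rewrite big_const_seq count_predT iter_muln_1. Qed.

(** Since the radical of m is at most m, one compares prime by prime: a divisor p >= B satisfies B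
    <= p, a divisor p < B contributes B p to both sides, and a non-divisor p < B contributes p on
    the left and B on the right. *)
Lemma omega_bound :
  B ^ size (primes m) * \prod_(p <- primes_below B) p
    <= B ^ size (primes_below B) * m.
Proof.
have lt_B p : p \in primes_below B -> p <= B.
  by rewrite mem_filter mem_iota add0n => /andP[_ /ltnW].
apply: leq_trans (leq_mul (leqnn _) (prod_primes_leq m_gt0)).
rewrite expn_size_primes [X in X * _](big_primes_split _ (fun=> B)).
rewrite [X in _ <= _ * X](big_primes_split _ id) /=.
rewrite -[B ^ _](_ : \prod_(p <- primes_below B) B = _); last first.
  by rewrite big_const_seq count_predT iter_muln_1.
rewrite [X in _ * X <= _](bigID (fun p => p %| m)) /=.
rewrite [X in _ <= X * _](bigID (fun p => p %| m)) /= mulnACA [X in _ <= X]mulnACA.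
rewrite leq_mul2l; apply/orP; right; rewrite mulnC leq_mul //; last exact: leq_prod.
by rewrite big_seq_cond [X in _ <= X]big_seq_cond leq_prod // => p /andP[/lt_B].
Qed.

(** The prime divisors of m that are at least B all divide r, so their product is at most r; k + 1
    of them would force r >= B^(k+1). *)
Lemma primes_size_cofactor r k : 0 < r -> r < B ^ k.+1 ->
  (forall p, prime p -> B <= p -> p %| m -> p %| r) ->
  \sum_(p <- primes m | B <= p) 1 <= k.
Proof.
move=> r_gt0 lt_r dvd_r; rewrite sum1_count -size_filter.
set s := [seq p <- primes m | B <= p].
pose s' := [seq p <- primes r | B <= p].
have le_s : size s <= size s'.
  apply: uniq_leq_size => [|p]; first exact/filter_uniq/primes_uniq.
  rewrite !mem_filter !mem_primes => /and4P[Bp p_pr _ dvd_p].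
  by rewrite Bp p_pr r_gt0 dvd_r.
have [B_le1 | B_gt1] := leqP B 1.
  by move: lt_r r_gt0; case: (B) B_le1 => [|[|//]] _; rewrite ?exp0n ?exp1n //; lia.
rewrite -ltnS -(ltn_exp2l _ _ B_gt1); apply: leq_ltn_trans lt_r.
apply: leq_trans (_ : B ^ size s' <= _); first by rewrite leq_exp2l.
apply: leq_trans (prod_primes_leq r_gt0); rewrite (bigID (leq B)) /=.
rewrite -[X in X <= _]muln1 leq_mul //.
  rewrite -big_filter -/s' -(count_predT s') -iter_muln_1 -big_const_seq.
  by rewrite big_seq [X in _ <= X]big_seq leq_prod // => p; rewrite mem_filter => /andP[].
rewrite big_seq_cond prodn_cond_gt0 // => p /andP[].
by rewrite mem_primes => /and3P[/prime_gt0].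
Qed.

Lemma size_primes_leq k :
  \sum_(p <- primes m | B <= p) 1 <= k ->
  size (primes m) <= count (dvdn^~ m) (primes_below B) + k.
Proof.
move=> le_k; rewrite -sum1_size (big_primes_split _ (fun=> 1)) /=.
by rewrite sum1_count leq_add2l.
Qed.

(** This is phi(m)/m = prod (1 - 1/p) with denominators cleared: the divisors p < B enter exactly,
    and each of the at most k others satisfies 1 - 1/p >= 1 - 1/B. *)
Lemma totient_geq k :
  \sum_(p <- primes m | B <= p) 1 <= k ->
  m * \prod_(p <- primes_below B | p %| m) p.-1 * B.-1 ^ k
   <= totient m * \prod_(p <- primes_below B | p %| m) p * B ^ k.
Proof.
move=> le_k.
have tot : totient m * \prod_(p <- primes m) p = m * \prod_(p <- primes m) p.-1.
  rewrite totientE // [X in _ = X * _](prod_prime_decomp m_gt0) prime_decompE big_map /=.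
  rewrite -!big_split /=; apply: eq_big_seq => p p_m.
  have l_gt0 : 0 < logn p m by rewrite logn_gt0.
  by rewrite -{2}(prednK l_gt0) expnS; lia.
rewrite (big_primes_split _ id) (big_primes_split _ predn) /= in tot.
set lg := \prod_(p <- primes m | B <= p) p in tot.
set lg1 := \prod_(p <- primes m | B <= p) p.-1 in tot.
have lg_gt0 : 0 < lg.
  rewrite /lg big_seq_cond prodn_cond_gt0 // => p /andP[].
  by rewrite mem_primes => /and3P[/prime_gt0].
have le_lg : B.-1 ^ k * lg <= lg1 * B ^ k.
  (* If there are fewer than k large primes, the e missing factors are padded by B - 1 <= B. *)
  rewrite -(subnKC le_k) !expnD; set e := k - _.
  rewrite mulnAC [X in _ <= X]mulnA; apply: leq_mul; last first.
    by case: e => // e; rewrite leq_exp2r // leq_pred.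
  rewrite !expn_sum /lg /lg1 -!big_split /=.
  rewrite big_seq_cond [X in _ <= X]big_seq_cond; apply: leq_prod => p.
  move=> /andP[_ le_Bp]; rewrite !expn1; nia.
rewrite -(leq_pmul2r lg_gt0).
have := leq_mul (leqnn (m * \prod_(p <- primes_below B | p %| m) p.-1)) le_lg.
rewrite mulnA => /leq_trans; apply.
by rewrite mulnA -[X in X * _]mulnA -tot; lia.
Qed.

End PrimeDivisors.

Definition criterion q n :=
  (4 ^ (size (primes (q ^ n).-1) + n) <= q ^ n) ||
  (q ^ n < totient (q ^ n).-1 + (q - 1) ^ n).

(** Both criteria are reduced to a partial factorization of m: its primes below B and a cofactor r
    that keeps all the others. *)
Lemma criterion_cofactor B q n r k (m := (q ^ n).-1) :
  0 < m -> 0 < r -> r < B ^ k.+1 ->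
  (forall p, prime p -> B <= p -> p %| m -> p %| r) ->
  (4 ^ (count (dvdn^~ m) (primes_below B) + k + n) <= q ^ n) ||
  ((q ^ n - (q - 1) ^ n) * \prod_(p <- primes_below B | p %| m) p * B ^ k
    < m * \prod_(p <- primes_below B | p %| m) p.-1 * B.-1 ^ k) ->
  criterion q n.
Proof.
move=> m_gt0 r_gt0 lt_r dvd_r; have le_k := primes_size_cofactor m_gt0 r_gt0 lt_r dvd_r.
case/orP=> [le_q | lt_m]; apply/orP; [left | right].
  by apply: leq_trans le_q; rewrite leq_exp2l // leq_add2r size_primes_leq.
have := leq_trans lt_m (totient_geq m_gt0 le_k).
rewrite -!mulnA; set c := _ * B ^ k; have [->|c_gt0] := posnP c.
  by rewrite !muln0.
by rewrite ltn_pmul2r // -/m; move: (totient m) (q ^ n) ((q - 1) ^ n) => *; lia.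
Qed.

(** * Certifying the criteria by binary computation *)

Local Notation to_nat := N.to_nat.

Lemma to_nat_mul a b : to_nat (N.mul a b) = to_nat a * to_nat b.
Proof. exact: N2Nat.inj_mul. Qed.

Lemma to_nat_pow a b : to_nat (N.pow a b) = to_nat a ^ to_nat b.
Proof.
rewrite N2Nat.inj_pow; elim: (to_nat b) => //= k ->.
by rewrite expnS.
Qed.

Lemma to_nat_leb a b : N.leb a b = (to_nat a <= to_nat b).
Proof. by apply/idP/idP => [/N.leb_le|]; [lia | move=> ?; apply/N.leb_le; lia]. Qed.

Lemma to_nat_ltb a b : N.ltb a b = (to_nat a < to_nat b).
Proof. by apply/idP/idP => [/N.ltb_lt|]; [lia | move=> ?; apply/N.ltb_lt; lia]. Qed.

Lemma to_nat_dvd a b : N.lt 0 a -> N.eqb (N.modulo b a) 0 = (to_nat a %| to_nat b).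
Proof.
move=> a_gt0; apply/N.eqb_spec/dvdnP => [/N.Div0.mod_divides[c ->] | [c]].
  by exists (to_nat c); rewrite to_nat_mul mulnC.
move=> eq_b; apply/N.Div0.mod_divides; exists (N.of_nat c).
by apply: N2Nat.inj; rewrite to_nat_mul Nat2N.id mulnC.
Qed.

(* Dividing by p at most k times is harmless even if p still divides the result:
   [check] only needs r to retain every prime divisor that is at least B. *)
Fixpoint strip (k : nat) (r p : N) : N :=
  if k is k'.+1 then
    if N.eqb (N.modulo r p) 0 then strip k' (N.div r p) p else r
  else r.

(* Nothing is proved about this function, since [check] tests r < B^(k + 1). *)
Fixpoint log_below (k : nat) (B r : N) : N :=
  if k is k'.+1 then
    if N.ltb r B then 0%num else N.succ (log_below k' B (N.div r B))
  else 0%num.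

(** The hypotheses of [criterion_cofactor], evaluated on binary numbers because q^n is far too large
    for unary ones. The fuel values 8 and 200 influence only whether the test succeeds, not its
    soundness. *)
Definition check (B : N) (ps : seq N) (q n : N) : bool :=
  let Q := N.pow q n in
  let m := N.pred Q in
  let sm := [seq p <- ps | N.eqb (N.modulo m p) 0] in
  let r := foldl (strip 8) m sm in
  let k := log_below 200 B r in
  [&& N.ltb 0 r, N.ltb r (N.pow B (N.succ k)) &
    N.leb (N.pow 4 (N.of_nat (size sm) + k + n)) Q ||
    N.ltb ((Q - N.pow (N.pred q) n) * foldr N.mul 1 sm * N.pow B k)
          (m * foldr N.mul 1 (map N.pred sm) * N.pow (N.pred B) k)]%num.

Lemma strip_dvd k r p l :
  prime l -> l != to_nat p -> prime (to_nat p) -> l %| to_nat r -> l %| to_nat (strip k r p).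
Proof.
move=> l_pr ne_lp p_pr; elim: k r => //= k IHk r dvd_r.
case: N.eqb_spec => // /N.Div0.mod_divides[c def_r].
have p_nz : p <> 0%num by move=> p0; move: p_pr; rewrite p0.
rewrite def_r N.mul_comm N.div_mul //; apply: IHk.
move: dvd_r; rewrite def_r to_nat_mul Euclid_dvdM // dvdn_prime2 //.
by rewrite (negPf ne_lp).
Qed.

Lemma to_nat_prod (s : seq N) : to_nat (foldr N.mul 1%num s) = \prod_(p <- map to_nat s) p.
Proof. by elim: s => [|p s IHs]; rewrite ?big_nil // big_cons /= to_nat_mul IHs. Qed.

Lemma check_criterion B ps q n : primes_below (to_nat B) = map to_nat ps ->
  check B ps q n -> 1 < to_nat q ^ to_nat n -> criterion (to_nat q) (to_nat n).
Proof.
move=> def_ps; rewrite /check; set Q := N.pow q n; set m := N.pred Q.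
set sm := filter _ _; set r := foldl _ _ _; set k := log_below _ _ _.
case/and3P; rewrite to_nat_ltb => r_gt0.
rewrite to_nat_ltb to_nat_pow N2Nat.inj_succ => lt_r ok gt1.
have def_m : to_nat m = (to_nat q ^ to_nat n).-1 by rewrite -to_nat_pow N2Nat.inj_pred.
have prime_ps p : p \in ps -> prime (to_nat p).
  move/(map_f to_nat); rewrite -def_ps mem_filter => /andP[]//.
have def_sm : map to_nat sm = [seq p <- primes_below (to_nat B) | p %| to_nat m].
  rewrite def_ps filter_map; congr (map _ _); apply: eq_in_filter => p ps_p /=.
  by rewrite to_nat_dvd //; move/prime_ps/prime_gt0: ps_p; lia.
apply: (criterion_cofactor (B := to_nat B) (r := to_nat r) (k := to_nat k)) => //.
- by rewrite -subn1 subn_gt0.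
- rewrite -def_m => l l_pr le_l dvd_l.
  (* Only primes p < B <= l are stripped, so l keeps dividing the running cofactor. *)
  have {def_sm}: all (fun p => (to_nat p < l) && prime (to_nat p)) sm.
    apply/allP=> p; rewrite mem_filter => /andP[_ ps_p].
    rewrite prime_ps // andbT; apply: leq_trans le_l.
    by move/(map_f to_nat): ps_p; rewrite -def_ps mem_filter mem_iota => /and3P[].
  rewrite /r; move: 8 => e.
  elim: (sm) (m) dvd_l => //= p s IHs m' dvd_l /andP[/andP[lt_p p_pr]].
  by apply: IHs; apply: strip_dvd; rewrite // gtn_eqF.
have prod_sm : to_nat (foldr N.mul 1%num sm)
    = \prod_(p <- primes_below (to_nat B) | p %| (to_nat q ^ to_nat n).-1) p.
  by rewrite to_nat_prod def_sm big_filter def_m.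
have prod_sm1 : to_nat (foldr N.mul 1%num (map N.pred sm))
    = \prod_(p <- primes_below (to_nat B) | p %| (to_nat q ^ to_nat n).-1) p.-1.
  rewrite to_nat_prod -map_comp (eq_map (g := predn \o to_nat)) => [|p /=]; last lia.
  by rewrite map_comp def_sm big_map big_filter def_m.
have size_sm : count (dvdn^~ (to_nat q ^ to_nat n).-1) (primes_below (to_nat B)) = size sm.
  by rewrite -size_filter -def_m -def_sm size_map.
move: ok; rewrite to_nat_leb to_nat_ltb !to_nat_mul !to_nat_pow prod_sm prod_sm1 size_sm.
rewrite !N2Nat.inj_add Nat2N.id !N2Nat.inj_pred N2Nat.inj_sub !to_nat_pow.
by rewrite N2Nat.inj_pred subn1.
Qed.

Definition primes20 : seq N := [:: 2; 3; 5; 7; 11; 13; 17; 19]%num.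
Definition primes128 : seq N := ([:: 2; 3; 5; 7; 11; 13; 17; 19; 23; 29; 31; 37; 41; 43; 47;
  53; 59; 61; 67; 71; 73; 79; 83; 89; 97; 101; 103; 107; 109; 113; 127])%num.

Lemma primes_below20 : primes_below 20 = map to_nat primes20. Proof. by vm_compute. Qed.
Lemma primes_below8 : primes_below 8 = map to_nat (take 4 primes20). Proof. by vm_compute. Qed.
Lemma primes_below128 : primes_below 128 = map to_nat primes128. Proof. by vm_compute. Qed.

Definition check_all B ps (qs ns : seq nat) :=
  all (fun q => all (fun n => check B ps (N.of_nat q) (N.of_nat n)) ns) qs.

Lemma check_allP B ps qs ns q n : primes_below (to_nat B) = map to_nat ps ->
  check_all B ps qs ns -> q \in qs -> n \in ns -> 1 < q -> 0 < n -> criterion q n.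
Proof.
move=> def_ps /allP all_q q_qs n_ns q_gt1 n_gt0.
have := check_criterion def_ps (allP (all_q q q_qs) n n_ns).
by rewrite !Nat2N.id; apply; rewrite -(exp1n n) ltn_exp2r.
Qed.

(** * Ranges of q and n in which a criterion holds *)

Lemma criterion_omega c q n (B := 4 ^ c.+1) : 1 < q -> 0 < n ->
  B ^ size (primes_below B) * B ^ n <= \prod_(p <- primes_below B) p * (q ^ c) ^ n ->
  criterion q n.
Proof.
move=> q_gt1 n_gt0 le_q; apply/orP; left.
have m_gt0 : 0 < (q ^ n).-1 by rewrite -subn1 subn_gt0 -(exp1n n) ltn_exp2r.
(* Raise 4^(omega(m) + n) <= q^n to the power c + 1 and multiply by P. After [omega_bound] and m <=
   q^n, a factor q^n cancels and [le_q] remains. *)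
rewrite -(leq_exp2r _ _ (ltn0Sn c)) -expnM mulnC expnM -/B expnD.
set P := \prod_(p <- _) p in le_q.
have P_gt0 : 0 < P by apply: prod_primes_below_gt0.
rewrite -(leq_pmul2r P_gt0) mulnAC.
apply: leq_trans (leq_mul (omega_bound B m_gt0) (leqnn _)) _.
apply: leq_trans (_ : B ^ size (primes_below B) * q ^ n * B ^ n <= _).
  by rewrite leq_mul // leq_mul // leq_pred.
rewrite expnAC in le_q.
by rewrite mulnAC mulnC expnS -mulnA leq_mul // [X in _ <= X]mulnC.
Qed.

(** Increasing n by 1 multiplies the left side by B and the right side by q^c >= q0^c >= B, so the
    single inequality at (q0, n0) settles a whole quadrant. *)
Lemma criterion_omega_mono c q0 n0 q n (B := 4 ^ c.+1) : B <= q0 ^ c -> 1 < q -> 0 < n ->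
  B ^ size (primes_below B) * B ^ n0 <= \prod_(p <- primes_below B) p * (q0 ^ c) ^ n0 ->
  q0 <= q -> n0 <= n -> criterion q n.
Proof.
move=> le_B q_gt1 n_gt0 le0 le_q le_n; apply: (@criterion_omega c) => //; rewrite -/B.
have le_qc : q0 ^ c <= q ^ c by case: (c) => // d; rewrite leq_exp2r.
apply: leq_trans (_ : \prod_(p <- primes_below B) p * (q0 ^ c) ^ n <= _); last first.
  by rewrite leq_mul2l leq_exp2r // le_qc orbT.
rewrite -(subnKC le_n) !expnD !mulnA leq_mul //.
by case: (n - n0) => // d; rewrite leq_exp2r.
Qed.

(* Bernoulli: [(a + 1)^n >= (a + n) a^(n-1)]. *)
Lemma leq_mul_expnS K a n : 0 < a -> a * K <= n -> K * a ^ n <= a.+1 ^ n.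
Proof.
move=> a_gt0 le_n.
have bern : n * a ^ n <= a * a.+1 ^ n.
  apply: leq_trans (_ : (a + n) * a ^ n <= _); first by rewrite leq_mul2r leq_addl orbT.
  elim: n {le_n} => [|n IHn]; first by rewrite addn0.
  rewrite !expnS; move: IHn; move: (a ^ n) (a.+1 ^ n) => x y.
  nia.
rewrite -(leq_pmul2l a_gt0); apply: leq_trans bern.
by rewrite mulnA leq_mul.
Qed.

Lemma criterion_eventually c q (B := 4 ^ c.+1) : 1 < q -> B < q ^ c ->
  exists N, forall n, N <= n -> criterion q n.
Proof.
move=> q_gt1 lt_B; have B_gt0 : 0 < B by rewrite expn_gt0.
pose K := B ^ size (primes_below B); have K_gt0 : 0 < K by rewrite expn_gt0 B_gt0.
(* As B + 1 <= q^c, Bernoulli gives K B^n <= (B + 1)^n <= (q^c)^n once n >= B K. *)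
exists (B * K) => n le_n.
have n_gt0 : 0 < n by apply: leq_trans le_n; rewrite muln_gt0 B_gt0.
apply: (@criterion_omega c) => //; rewrite -/B -/K.
apply: leq_trans (leq_mul_expnS B_gt0 le_n) _.
apply: leq_trans (_ : (q ^ c) ^ n <= _); first by rewrite leq_exp2r.
by rewrite leq_pmull // prod_primes_below_gt0.
Qed.

Lemma criterion_omega_mono_N B c (ps : seq N) q0 n0 q n :
  to_nat B = 4 ^ (to_nat c).+1 -> primes_below (to_nat B) = map to_nat ps -> (B <=? q0 ^ c)%num ->
  (B ^ N.of_nat (size ps) * B ^ n0 <=? foldr N.mul 1 ps * (q0 ^ c) ^ n0)%num ->
  to_nat q0 <= q -> to_nat n0 <= n -> 1 < q -> 0 < n -> criterion q n.
Proof.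
move=> tB def_ps; rewrite !to_nat_leb !to_nat_mul !to_nat_pow to_nat_prod Nat2N.id -def_ps.
rewrite -(size_map to_nat) -def_ps tB => le_B le0 le_q le_n q_gt1 n_gt0.
exact: criterion_omega_mono le_B q_gt1 n_gt0 le0 le_q le_n.
Qed.

Lemma primes_below16 : primes_below 16 = map to_nat (take 6 primes128). Proof. by vm_compute. Qed.
Lemma primes_below64 : primes_below 64 = map to_nat (take 18 primes128). Proof. by vm_compute. Qed.

(** Each corner is a pair at which the inequality of [criterion_omega_mono] is evaluated: with B =
    64, c = 2 for the first four quadrants and with B = 16, c = 1 for the last three. *)
Lemma criterion_regions q n : 2 <= n ->
  [|| (11 <= q) && (35 <= n), (13 <= q) && (23 <= n), (16 <= q) && (16 <= n),
      (49 <= q) && (6 <= n), (78 <= q) && (4 <= n), (132 <= q) && (3 <= n) | 379 <= q] ->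
  criterion q n.
Proof.
move=> n_ge2 reg.
have n_gt0 : 0 < n by lia.
have q_gt1 : 1 < q by lia.
have reg64 := fun q0 n0 ok1 ok2 =>
  @criterion_omega_mono_N 64 2 _ q0 n0 q n erefl primes_below64 ok1 ok2.
have reg16 := fun q0 n0 ok1 ok2 =>
  @criterion_omega_mono_N 16 1 _ q0 n0 q n erefl primes_below16 ok1 ok2.
case/or4P: reg => [/andP[le_q le_n]|/andP[le_q le_n]|/andP[le_q le_n]|].
- exact: (reg64 11%num 35%num isT isT le_q le_n q_gt1 n_gt0).
- exact: (reg64 13%num 23%num isT isT le_q le_n q_gt1 n_gt0).
- exact: (reg64 16%num 16%num isT isT le_q le_n q_gt1 n_gt0).
case/or4P=> [/andP[le_q le_n]|/andP[le_q le_n]|/andP[le_q le_n]|le_q].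
- exact: (reg64 49%num 6%num isT isT le_q le_n q_gt1 n_gt0).
- exact: (reg16 78%num 4%num isT isT le_q le_n q_gt1 n_gt0).
- exact: (reg16 132%num 3%num isT isT le_q le_n q_gt1 n_gt0).
exact: (reg16 379%num 2%num isT isT le_q n_ge2 q_gt1 n_gt0).
Qed.

Lemma criterion_small B ps q0 dq n0 dn q n : primes_below (to_nat B) = map to_nat ps ->
  check_all B ps (iota q0 dq) (iota n0 dn) ->
  q0 <= q < q0 + dq -> n0 <= n < n0 + dn -> 1 < q0 -> 0 < n0 -> criterion q n.
Proof.
move=> def_ps ok q_in n_in q0_gt1 n0_gt0.
by apply: check_allP def_ps ok _ _ _ _; rewrite ?mem_iota //; lia.
Qed.

(** The pairs outside the quadrants form four rectangles: q < 49 with n < 16, q < 78 with n < 6, q <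
    132 with n < 4, and q < 379 with n = 2. A criterion is purely arithmetic, so every integer q is
    tested, prime power or not. *)
Lemma criterion_ge16 q n : 16 <= q -> 2 <= n -> criterion q n.
Proof.
move=> q_ge n_ge.
have small1 := @criterion_small 20 primes20 16 33 2 14 q n primes_below20.
have small2 := @criterion_small 8 _ 49 29 2 4 q n primes_below8.
have small3 := @criterion_small 8 _ 78 54 2 2 q n primes_below8.
have small4 := @criterion_small 8 _ 132 247 2 1 q n primes_below8.
have reg := @criterion_regions q n n_ge.
have [lt49|ge49] := ltnP q 49.
  have [n_ge16|n_lt16] := leqP 16 n; first by apply: reg; lia.
  apply: small1; by [vm_compute | lia].
have [lt78|ge78] := ltnP q 78.
  have [n_ge16|n_lt16] := leqP 6 n; first by apply: reg; lia.
  apply: small2; by [vm_compute | lia].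
have [lt132|ge132] := ltnP q 132.
  have [n_ge16|n_lt16] := leqP 4 n; first by apply: reg; lia.
  apply: small3; by [vm_compute | lia].
have [n_ge16|n_lt16] := leqP 3 n; first by apply: reg; lia.
have [lt379|ge379] := ltnP q 379; last by apply: reg; lia.
apply: small4; by [vm_compute | lia].
Qed.

Lemma criterion13 n : 2 <= n -> n <> 4 -> criterion 13 n.
Proof.
move=> n_ge n_neq.
have [n_ge23|n_lt23] := leqP 23 n; first by apply: criterion_regions; lia.
have n_in : n \in [:: 2, 3 & iota 5 18] by rewrite 2!in_cons mem_iota; lia.
have ok : check_all 128 primes128 [:: 13] [:: 2, 3 & iota 5 18] by vm_compute.
by apply: (@check_allP 128) primes_below128 ok _ n_in _ _ => //; lia.
Qed.

Lemma criterion11 n : 2 <= n -> n \notin [:: 4; 6; 12] -> criterion 11 n.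
Proof.
move=> n_ge n_neq.
have [n_ge35|n_lt35] := leqP 35 n; first by apply: criterion_regions; lia.
have n_in : n \in [:: 2, 3, 5 & iota 7 5 ++ iota 13 22].
  by rewrite !inE in n_neq; rewrite 3!in_cons mem_cat !mem_iota; lia.
have ok : check_all 128 primes128 [:: 11] [:: 2, 3, 5 & iota 7 5 ++ iota 13 22].
  by vm_compute.
by apply: (@check_allP 128) primes_below128 ok _ n_in _ _ => //; lia.
Qed.

Lemma criterion_7_8_9 : exists N : nat -> nat, forall q n,
  q \in [:: 7; 8; 9] -> N q <= n -> criterion q n.
Proof.
have ex q : 1 < q -> 4 ^ 4 < q ^ 3 -> exists N, forall n, N <= n -> criterion q n.
  (* Here [c = 3] means B = 4^4 = 256 < 343 = 7^3; [c = 2] would give B = 64, which is not below 7^2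
     or 8^2. *)
  exact: (@criterion_eventually 3).
have [N7 ok7] : exists N, forall n, N <= n -> criterion 7 n by apply: ex; vm_compute.
have [N8 ok8] : exists N, forall n, N <= n -> criterion 8 n by apply: ex; vm_compute.
have [N9 ok9] : exists N, forall n, N <= n -> criterion 9 n by apply: ex; vm_compute.
exists (fun=> maxn N7 (maxn N8 N9)) => q n; rewrite !inE !geq_max.
by case/or3P=> /eqP-> /and3P[*]; auto.
Qed.

Import Order.TTheory GRing.Theory Num.Theory FinRing.Theory.
Import GroupScope.
Local Open Scope ring_scope.

(** * Fourier analysis on finite abelian groups *)

Section Fourier.
Variable gT : finGroupType.
Let G := [set: gT]%G.
Hypothesis abG : abelian G.
Implicit Types (f g : gT -> algC) (i j k : Iirr G).

(** The irreducible characters of the abelian group G are linear, so [Iirr G] indexes the dual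
    group. *)
Definition fcoef f i : algC := #|G|%:R^-1 * \sum_x f x * ('chi[G]_i x)^*.
Definition fnorm f : algC := \sum_i `|fcoef f i|.

Lemma irr_abelian_lin i : 'chi[G]_i \is a linear_char.
Proof. by move/char_abelianP: abG. Qed.
Hint Resolve irr_abelian_lin : core.

Lemma irrM i x y : 'chi[G]_i (x * y)%g = 'chi_i x * 'chi_i y.
Proof. by rewrite lin_charM ?inE. Qed.

Lemma irr0_val x : 'chi[G]_0 x = 1.
Proof. by rewrite irr0 cfun1E inE. Qed.

Lemma irr_norm1 i x : `|'chi[G]_i x| = 1.
Proof. by rewrite normC_lin_char ?inE. Qed.

(** Column orthogonality of the character table, all conjugacy classes being singletons. *)
Lemma fourier_inversion f x : f x = \sum_i fcoef f i * 'chi_i x.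
Proof.
transitivity (\sum_y #|G|%:R^-1 * f y * \sum_i 'chi[G]_i x * ('chi_i y)^*); last first.
  under eq_bigr do rewrite mulr_sumr.
  rewrite exchange_big /=; apply: eq_bigr => i _.
  rewrite /fcoef mulr_sumr mulr_suml; apply: eq_bigr => y _.
  by rewrite -!mulrA ['chi_i x * _]mulrC.
have orth y : \sum_i 'chi[G]_i x * ('chi_i y)^* = #|G|%:R *+ (x == y).
  rewrite second_orthogonality_relation ?inE //.
  rewrite (abelian_classP _ abG) ?inE // (setIidPl _) //.
  by rewrite sub_cent1 (subsetP abG) ?inE.
rewrite (bigD1 x) //= orth eqxx mulr1n mulrAC mulVf ?neq0CG // mul1r.
rewrite big1 ?addr0 // => y ne_yx.
by rewrite orth eq_sym (negPf ne_yx) mulr0.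
Qed.

Lemma fcoef_irr i j : fcoef 'chi_i j = (i == j)%:R.
Proof.
rewrite -cfdot_irr cfdotE /fcoef; congr (_ * _).
by apply: eq_bigl => x; rewrite inE.
Qed.

Lemma eq_fcoef f g i : f =1 g -> fcoef f i = fcoef g i.
Proof. by move=> eq_fg; congr (_ * _); apply: eq_bigr => x _; rewrite eq_fg. Qed.

Lemma eq_fnorm f g : f =1 g -> fnorm f = fnorm g.
Proof. by move=> eq_fg; apply: eq_bigr => i _; rewrite (eq_fcoef _ eq_fg). Qed.

Lemma fnorm_irr i : fnorm 'chi_i = 1.
Proof.
rewrite /fnorm (bigD1 i) //= big1 => [|j ne_ji]; rewrite fcoef_irr.
  by rewrite eqxx normr1 addr0.
by rewrite eq_sym (negPf ne_ji) normr0.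
Qed.

Lemma fnorm_ge0 f : 0 <= fnorm f.
Proof. by apply: sumr_ge0. Qed.

Lemma fcoef_sum (I : finType) (c : I -> algC) (F : I -> gT -> algC) i :
  fcoef (fun x => \sum_k c k * F k x) i = \sum_k c k * fcoef (F k) i.
Proof.
rewrite /fcoef.
under eq_bigr do rewrite mulr_suml.
rewrite exchange_big mulr_sumr; apply: eq_bigr => k _ /=.
by rewrite mulrCA !mulr_sumr; apply: eq_bigr => x _; rewrite !mulrA.
Qed.

Lemma fnorm_sum (I : finType) (c : I -> algC) (F : I -> gT -> algC) :
  fnorm (fun x => \sum_k c k * F k x) <= \sum_k `|c k| * fnorm (F k).
Proof.
under [leRHS]eq_bigr do rewrite mulr_sumr.
rewrite exchange_big; apply: ler_sum => i _ /=.
rewrite fcoef_sum; apply: le_trans (ler_norm_sum _ _ _) _.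
by apply: ler_sum => k _; rewrite normrM.
Qed.

Lemma fnorm_irrM i j : fnorm (fun x => 'chi_i x * 'chi_j x) = 1.
Proof.
have /irrP[k Dk] := mul_lin_irr (irr_abelian_lin i) (mem_irr j).
by rewrite -(fnorm_irr k) -Dk; apply: eq_fnorm => x; rewrite cfunE.
Qed.

(** Expand f and g in characters; a product of two characters is again a linear character, of norm
    1, and the triangle inequality concludes. *)
Lemma fnormM f g : fnorm (fun x => f x * g x) <= fnorm f * fnorm g.
Proof.
pose c (p : Iirr G * Iirr G) := fcoef f p.1 * fcoef g p.2.
pose F (p : Iirr G * Iirr G) x := 'chi_p.1 x * 'chi_p.2 x.
rewrite (@eq_fnorm _ (fun x => \sum_p c p * F p x)); last first.
  move=> x; rewrite (fourier_inversion f) (fourier_inversion g) mulr_suml.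
  under eq_bigr do rewrite mulr_sumr.
  by rewrite pair_big; apply: eq_bigr => p _; rewrite mulrACA.
apply: le_trans (fnorm_sum _ _) _.
rewrite mulr_suml; under [leRHS]eq_bigr do rewrite mulr_sumr.
by rewrite pair_big; apply: ler_sum => p _; rewrite fnorm_irrM mulr1 normrM.
Qed.

Lemma fnorm1 : fnorm (fun=> 1) = 1.
Proof.
by rewrite -[RHS](fnorm_irr 0); apply: eq_fnorm => x; rewrite irr0_val.
Qed.

Lemma fnorm_prod (I : Type) (s : seq I) (F : I -> gT -> algC) :
  fnorm (fun x => \prod_(k <- s) F k x) <= \prod_(k <- s) fnorm (F k).
Proof.
elim: s => [|k s IHs].
  by rewrite big_nil (@eq_fnorm _ (fun=> 1)) ?fnorm1 // => x; rewrite big_nil.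
rewrite big_cons (@eq_fnorm _ (fun x => F k x * \prod_(l <- s) F l x)); last first.
  by move=> x; rewrite big_cons.
by apply: le_trans (fnormM _ _) _; rewrite ler_wpM2l ?fnorm_ge0.
Qed.

Lemma irr_sum_neq0 i : i != 0 -> \sum_x 'chi[G]_i x = 0.
Proof.
move=> nz_i; have /eqP := fcoef_irr i 0; rewrite (negPf nz_i) mulf_eq0 invr_eq0.
rewrite (negPf (neq0CG G)) => /eqP sum0; rewrite -[RHS]sum0.
by apply: eq_bigr => x _; rewrite irr0_val rmorph1 mulr1.
Qed.

(* The coefficients of 1_H are nonnegative and sum to 1_H(1) = 1; translating
   H by u only multiplies them by complex numbers of modulus 1. *)
Lemma fnorm_coset_compl (H : {group gT}) u :
  fnorm (fun x => (x \notin (u *: H)%g)%:R) <= 2 * (1 - #|H|%:R / #|G|%:R).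
Proof.
pose S i := \sum_(h in H) ('chi[G]_i h)^*.
pose a i := #|G|%:R^-1 * S i.
have G_gt0 : 0 < #|G|%:R :> algC by rewrite ltr0n cardG_gt0.
have fcH i : fcoef (fun x => (x \in H)%:R) i = a i.
  congr (_ * _); rewrite /S [RHS]big_mkcond; apply: eq_bigr => x _ /=.
  by case: ifP; rewrite ?mul1r ?mul0r.
have a_ge0 i : 0 <= a i.
  have a_eq : a i = #|G|%:R^-1 * S i by [].
  rewrite a_eq pmulr_rge0 ?invr_gt0 //.
  (* Translation invariance; summed over h it gives S^2 = |H| S, so S is 0 or |H|, hence
     nonnegative. *)
  have Sh h : h \in H -> ('chi[G]_i h)^* * S i = S i.
    move=> Hh; rewrite mulr_sumr [RHS](reindex_inj (mulgI h)) /=.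
    by apply: eq_big => y; rewrite ?groupMl // => _; rewrite irrM rmorphM.
  have /eqP : S i * (S i - #|H|%:R) = 0.
    by rewrite mulrBr mulr_natr {1}/S mulr_suml (eq_bigr _ Sh) sumr_const subrr.
  by rewrite mulf_eq0 subr_eq0 => /orP[] /eqP->; rewrite ?lexx ?ler0n.
have a_sum : \sum_i a i = 1.
  have e := fourier_inversion (fun x => (x \in H)%:R) 1%g.
  rewrite /= group1 in e; rewrite -[RHS]/(true%:R) e.
  by apply: eq_bigr => i _; rewrite fcH lin_char1 ?mulr1.
have a0 : a 0 = #|H|%:R / #|G|%:R.
  rewrite /a /S (eq_bigr (fun=> 1)) ?sumr_const 1?mulrC // => h _.
  by rewrite irr0_val rmorph1.
have fcu i : fcoef (fun x => (x \notin (u *: H)%g)%:R) i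
             = (i == 0)%:R - ('chi_i u)^* * a i.
  have -> : (i == 0)%:R = fcoef (fun=> 1) i.
    rewrite eq_sym -(fcoef_irr 0 i); apply: eq_fcoef => x.
    by rewrite irr0_val.
  have -> : ('chi_i u)^* * a i = fcoef (fun x => (x \in (u *: H)%g)%:R) i.
    rewrite mulrCA; congr (_ * _); rewrite mulr_sumr [RHS](reindex_inj (mulgI u)) /=.
    rewrite big_mkcond; apply: eq_bigr => x _.
    rewrite mem_lcoset mulKg irrM rmorphM /=.
    by case: ifP; rewrite ?mul1r ?mul0r.
  rewrite /fcoef -mulrBr -sumrB; congr (_ * _); apply: eq_bigr => x _.
  by rewrite -mulrBl; case: (x \in _); rewrite ?subr0 ?subrr.
(* The trivial coefficient is 1 - |H|/|G|, and the absolute values of the others also sum to this,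
   whence the factor 2. *)
rewrite /fnorm (bigD1 0) //= fcu eqxx irr0_val conjC1 mul1r a0.
have le1 : 0 <= 1 - #|H|%:R / #|G|%:R :> algC.
  by rewrite subr_ge0 ler_pdivrMr // mul1r ler_nat subset_leq_card ?subsetT.
rewrite ger0_norm // mulrDl !mul1r lerD2l -a0 -[in leRHS]a_sum.
rewrite [in leRHS](bigD1 0) //= addrAC subrr add0r.
apply: ler_sum => i /negPf nz_i.
by rewrite fcu nz_i sub0r normrN normrM norm_conjC irr_norm1 mul1r ger0_norm.
Qed.

End Fourier.

(** * Gauss sums and generators *)

Section Generators.
Variables (gT : finGroupType) (g : gT).
Hypothesis gen_g : [set: gT] = <[g]>%g.
Let m := #|[set: gT]|.

Let cycT : cyclic [set: gT].
Proof. by apply/cyclicP; exists g. Qed.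

Let abT : abelian [set: gT].
Proof. exact: cyclic_abelian. Qed.

Let order_g : #[g]%g = m.
Proof. by rewrite /m gen_g. Qed.

Lemma card_powers p : p \in primes m -> #|<[g ^+ p]>%g| = (m %/ p)%N.
Proof.
by rewrite mem_primes => /and3P[_ _ dvd_p]; rewrite -orderE orderXdiv order_g.
Qed.

(** If u does not generate, take a prime p dividing m / #[u]. Then #[u] divides m / p, and in a
    cyclic group divisibility of orders means inclusion of subgroups, so u lies in the subgroup of
    index p. *)
Lemma generator_powers u :
  generator [set: gT] u = all (fun p => u \notin <[g ^+ p]>%g) (primes m).
Proof.
have m_gt0 : (0 < m)%N by apply: cardG_gt0.
apply/idP/allP => [gen_u p p_m | notin].
  have := p_m; rewrite mem_primes => /and3P[p_pr _ dvd_p].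
  apply/negP => u_in; have : (m <= m %/ p)%N.
    rewrite -card_powers // subset_leq_card //.
    by rewrite (eqP gen_u) cycle_subG.
  by rewrite leqNgt ltn_Pdiv ?prime_gt1.
apply/negPn/negP => not_gen.
have dvd_u : (#[u] %| m)%N by apply/order_dvdG/in_setT.
have lt_u : (#[u] < m)%N.
  rewrite ltn_neqAle dvdn_leq // andbT; apply: contra not_gen => /eqP eq_u.
  by rewrite /generator eq_sym eqEcard subsetT /= -/m -eq_u leqnn.
have d_gt1 : (1 < m %/ #[u])%N by rewrite ltn_divRL ?mul1n.
set p := pdiv (m %/ #[u])%N.
have p_pr : prime p by apply: pdiv_prime.
have dvd_pd : (p %| m %/ #[u])%N by apply: pdiv_dvd.
have dvd_pm : (p %| m)%N by apply: dvdn_trans dvd_pd (dvdn_div dvd_u).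
have p_m : p \in primes m by rewrite mem_primes p_pr m_gt0.
have /negP[] := notin _ p_m; rewrite -cycle_subG.
rewrite -(cardSg_cyclic cycT) ?subsetT // card_powers //.
by rewrite dvdn_divRL // mulnC -dvdn_divRL.
Qed.

Definition gen_weight u : algC := (generator [set: gT] u)%:R.

Lemma totient_prod n : (0 < n)%N ->
  (totient n)%:R / n%:R = \prod_(p <- primes n) (1 - p%:R^-1) :> algC.
Proof.
move=> n_gt0; rewrite totientE // [X in _ / X%:R](prod_prime_decomp n_gt0).
rewrite prime_decompE big_map !natr_prod -prodf_div; apply: eq_big_seq => p.
rewrite mem_primes => /and3P[p_pr _ dvd_p] /=.
have nzp : p%:R != 0 :> algC by rewrite pnatr_eq0 -lt0n prime_gt0.
have l_gt0 : (0 < logn p n)%N by rewrite logn_gt0 mem_primes p_pr n_gt0.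
rewrite -{2}(prednK l_gt0) expnS !natrM -mulf_div divff ?mulr1; last first.
  by rewrite natrX expf_neq0.
by rewrite -subn1 natrB ?prime_gt0 // mulrBl divff // mul1r.
Qed.

Lemma gen_weight_coef0 : fcoef gen_weight 0 = (totient m)%:R / m%:R.
Proof.
rewrite /fcoef mulrC; congr (_ / _).
rewrite (eq_bigr gen_weight) => [|x _]; last by rewrite irr0_val conjC1 mulr1.
rewrite -order_g totient_gen -sum1_card natr_sum [RHS]big_mkcond /=.
apply: eq_bigr => x _; rewrite inE -gen_g /gen_weight.
by case: generator.
Qed.

Lemma gen_weight_norm :
  fnorm gen_weight <= 2 ^+ size (primes m) * ((totient m)%:R / m%:R).
Proof.
pose F p u : algC := (u \notin (1 *: <[g ^+ p]>)%g)%:R.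
rewrite (@eq_fnorm _ _ (fun u => \prod_(p <- primes m) F p u)); last first.
  move=> u; rewrite /gen_weight generator_powers /F.
  elim: (primes m) => [|p s IHs]; first by rewrite big_nil.
  by rewrite big_cons /= lcoset1 -IHs -natrM mulnb.
apply: le_trans (fnorm_prod abT _ _) _.
rewrite totient_prod ?cardG_gt0 //.
rewrite -[X in X * _](_ : \prod_(p <- primes m) 2 = _); last first.
  by rewrite big_const_seq count_predT iter_mulr_1.
rewrite -big_split /= big_seq [leRHS]big_seq.
apply: ler_prod => p p_m; rewrite fnorm_ge0 /=.
apply: le_trans (fnorm_coset_compl abT _ _) _.
rewrite card_powers // -/m.
have := p_m; rewrite mem_primes => /and3P[p_pr m_gt0 dvd_p].
rewrite natf_div // mulrAC divff ?mul1r ?pnatr_eq0 -?lt0n //.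
Qed.

End Generators.

(** * Gauss sums and sums mixing additive and multiplicative weights *)

Section GaussSums.
Variable E : finFieldType.

Lemma unit_cyclic : cyclic [set: {unit E}].
Proof. exact: field_unit_group_cyclic. Qed.
Let abU : abelian [set: {unit E}] := cyclic_abelian unit_cyclic.
Let abE : abelian [set: E] := zmod_abelian _.

(* The sum g(c) twisted by c vanishes at c = 0 and |g(c)| does not depend on the
   unit c, so Parseval for c |-> g(c) determines |g(1)|. *)
Lemma gauss_sum_bound (i : Iirr [set: {unit E}]) (j : Iirr [set: E]) :
  i != 0 -> `|\sum_u 'chi_i u * 'chi_j (val u)| <= sqrtC #|E|%:R.
Proof.
move=> nz_i; have [-> | nz_j] := eqVneq j 0.
  under eq_bigr do rewrite irr0_val mulr1.
  by rewrite irr_sum_neq0 // normr0 sqrtC_ge0 ler0n.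
pose g (c : E) := \sum_u 'chi_i u * 'chi_j (c * val u).
have -> : \sum_u 'chi_i u * 'chi_j (val u) = g 1.
  by apply: eq_bigr => u _; rewrite mul1r.
(* Substituting v^-1 u for u pulls out the factor chi_i(v^-1), of modulus 1. *)
have g_unit (v : {unit E}) : `|g (val v)| = `|g 1|.
  rewrite -[RHS]mul1r -(irr_norm1 abU i v^-1%g) -normrM; congr (`|_|).
  rewrite mulr_sumr [LHS](reindex_inj (mulgI v^-1%g)).
  apply: eq_bigr => u _; rewrite irrM // -mulrA mul1r.
  by rewrite -FinRing.val_unitM mulKVg.
have sum_j a : \sum_c 'chi_j (c * a) = #|E|%:R *+ (a == 0).
  have [-> | nz_a] := eqVneq a 0.
    rewrite (eq_bigr (fun=> 1)) ?sumr_const // => c _.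
    by rewrite mulr0 -(lin_char1 (irr_abelian_lin abE j)).
  rewrite -[RHS](irr_sum_neq0 nz_j) [RHS](reindex_inj (mulIf nz_a)) //.
pose m : algC := #|[set: {unit E}]|%:R.
(* Expand the square and sum over c first: only the diagonal terms u = v survive. *)
have sum_g : \sum_c `|g c| ^+ 2 = #|E|%:R * m.
  transitivity (\sum_u \sum_v 'chi_i u * ('chi_i v)^* *
                  \sum_c 'chi_j (c * (val u - val v))).
    rewrite (eq_bigr (fun c => \sum_u \sum_v 'chi_i u * 'chi_j (c * val u) *
                         ('chi_i v * 'chi_j (c * val v))^*)) => [|c _]; last first.
      rewrite normCK rmorph_sum mulr_suml.
      by apply: eq_bigr => u _; rewrite mulr_sumr.
    rewrite exchange_big; apply: eq_bigr => u _ /=.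
    rewrite exchange_big; apply: eq_bigr => v _ /=.
    rewrite mulr_sumr; apply: eq_bigr => c _.
    rewrite mulrBr -zmodMgE irrM // -zmodVgE lin_charV_conj ?inE ?irr_abelian_lin //.
    by rewrite rmorphM mulrACA.
  rewrite (eq_bigr (fun=> #|E|%:R)) => [|u _].
    by rewrite sumr_const /m cardsT mulr_natr.
  rewrite (bigD1 u) // sum_j subrr eqxx mulr1n -normCK irr_norm1 // expr1n mul1r.
  rewrite big1 /= ?addr0 // => v ne_vu.
  by rewrite sum_j subr_eq0 eq_sym (inj_eq val_inj) (negPf ne_vu) mulr0.
have le_g : m * `|g 1| ^+ 2 <= \sum_c `|g c| ^+ 2.
  rewrite (bigID [in [set val u | u in [set: {unit E}]]]) /=.
  rewrite big_imset /=; last by move=> u v _ _; apply: val_inj.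
  rewrite (eq_bigr (fun=> `|g 1| ^+ 2)) => [|u _]; last by rewrite g_unit.
  rewrite sumr_const -mulr_natl lerDl sumr_ge0 // => c _.
  by rewrite exprn_ge0.
have m_gt0 : 0 < m by rewrite ltr0n cardG_gt0.
move: le_g; rewrite sum_g mulrC ler_pM2r // => le_g.
by rewrite -(ler_pXn2r (n := 2)) ?nnegrE ?sqrtC_ge0 ?ler0n ?sqrtCK.
Qed.

(** Expand w in multiplicative characters; the trivial one yields the main term. For each other one,
    expand f in additive characters and bound the resulting Gauss sums. *)
Lemma fourier_sum_bound (f : E -> algC) (w : {unit E} -> algC) :
  `|\sum_u f (val u) * w u - fcoef w 0 * \sum_(u : {unit E}) f (val u)|
    <= (fnorm w - `|fcoef w 0|) * (fnorm f * sqrtC #|E|%:R).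
Proof.
have -> : \sum_u f (val u) * w u =
    \sum_i fcoef w i * \sum_(u : {unit E}) f (val u) * 'chi_i u.
  under [RHS]eq_bigr do rewrite mulr_sumr.
  rewrite exchange_big; apply: eq_bigr => u _ /=.
  rewrite (fourier_inversion abU w) mulr_sumr; apply: eq_bigr => i _.
  by rewrite mulrCA.
have s0 : \sum_(u : {unit E}) f (val u) * 'chi[[set: {unit E}]]_0 u = \sum_(u : {unit E}) f (val u).
  by apply: eq_bigr => u _; rewrite irr0_val mulr1.
rewrite (bigD1 0) //= s0 [X in `|X|]addrAC subrr add0r /fnorm.
rewrite [X in _ <= (X - _) * _](bigD1 0) //= addrAC subrr add0r.
apply: le_trans (ler_norm_sum _ _ _) _; rewrite mulr_suml.
apply: ler_sum => i nz_i; rewrite normrM ler_wpM2l //.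
have -> : \sum_(u : {unit E}) f (val u) * 'chi_i u =
    \sum_j fcoef f j * \sum_u 'chi_i u * 'chi_j (val u).
  under [RHS]eq_bigr do rewrite mulr_sumr.
  rewrite exchange_big; apply: eq_bigr => u _ /=.
  rewrite (fourier_inversion abE f) mulr_suml; apply: eq_bigr => j _.
  by rewrite mulrCA mulrA mulrC mulrA.
apply: le_trans (ler_norm_sum _ _ _) _; rewrite mulr_suml.
by apply: ler_sum => j _; rewrite normrM ler_wpM2l // gauss_sum_bound.
Qed.

End GaussSums.

(** * Avoiding hyperplanes *)

Lemma prodrD_subset (R : comNzRingType) (I : finType) (C : {set I}) (F G : I -> R) :
  \prod_(i in C) (F i + G i) =
  \sum_(D : {set I} | D \subset C)
     (\prod_(i in D) F i) * (\prod_(i in C :\: D) G i).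
Proof.
(* With the values 0 and 1 outside C the product extends to all of I, and every D not contained in C
   contributes 0. *)
pose F1 i := if i \in C then F i else 0.
pose G1 i := if i \in C then G i else 1.
rewrite big_mkcond (eq_bigr (fun i => F1 i + G1 i)) => [|i _]; last first.
  by rewrite /F1 /G1; case: ifP; rewrite ?add0r.
rewrite bigA_distr (bigID (fun D : {set I} => D \subset C)) /=.
rewrite [X in _ + X]big1 ?addr0 => [|D /subsetPn[i Di /negPf nCi]]; last first.
  by rewrite (bigD1 i) //= Di /F1 nCi mul0r.
apply: eq_bigr => D sDC; rewrite (bigID [in D]) /=; congr (_ * _).
  by apply: eq_bigr => i Di; rewrite Di /F1 (subsetP sDC).
rewrite [RHS]big_mkcond [LHS]big_mkcond; apply: eq_bigr => i _.
by rewrite inE /G1; case: (i \in D).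
Qed.

Lemma card_bigcap_setC (T : finType) (C : {set {set T}}) (q n : nat) :
  #|C| = n ->
  (forall D : {set {set T}}, D \subset C -> #|\bigcap_(A in D) A| = (q ^ (n - #|D|))%N) ->
  #|\bigcap_(A in C) ~: A|%:R = (q%:R - 1) ^+ n :> algC.
Proof.
move=> cardC cardD; pose b x (A : {set T}) : algC := (x \in A)%:R.
have in_cap x (D : {set {set T}}) (B : {set T} -> {set T}) :
    (x \in \bigcap_(A in D) B A)%:R = \prod_(A in D) b x (B A).
  have [/bigcapP in_all | notin] := boolP (x \in _).
    by rewrite big1 // => A DA; rewrite /b in_all.
  have [A DA nAx] : exists2 A, A \in D & x \notin B A.
    apply/exists_inP; rewrite -negb_forall_in; apply: contra notin.
    by move/forall_inP=> in_all; apply/bigcapP.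
  by rewrite (bigD1 A) //= /b (negPf nAx) mul0r.
rewrite -sum1_card natr_sum big_mkcond /=.
transitivity (\sum_x \sum_(D : {set {set T}} | D \subset C)
                (-1) ^+ #|D| * (x \in \bigcap_(A in D) A)%:R : algC).
  apply: eq_bigr => x _; transitivity (\prod_(A in C) (- b x A + 1)).
    rewrite -[LHS]/(if _ then 1 else 0) -[LHS](_ : (x \in \bigcap_(A in C) ~: A)%:R = _).
      rewrite in_cap; apply: eq_bigr => A _; rewrite /b inE.
      by case: (x \in A); rewrite ?addNr ?oppr0 ?add0r.
    by case: (x \in _).
  rewrite prodrD_subset; apply: eq_bigr => D sDC.
  by rewrite [X in _ * X]big1 ?mulr1 // prodrN in_cap.
rewrite exchange_big -cardC -prodr_const.
under [RHS]eq_bigr do rewrite addrC.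
(* The power (q - 1)^n, written as a product of n factors -1 + q, is expanded over the same subsets
   D, so the terms match without binomial coefficients. *)
rewrite prodrD_subset; apply: eq_bigr => D sDC /=.
rewrite -mulr_sumr !prodr_const cardsDS // cardC -natrX -cardD //.
congr (_ * _); rewrite -sum1_card natr_sum [RHS]big_mkcond /=.
by apply: eq_bigr => x _; case: (x \in _).
Qed.


(** * Generators of the unit group outside n cosets of index q *)

Section AvoidingCosets.
Variables (E : finFieldType) (q n : nat) (C : {set {set E}}).
Hypotheses (q_gt1 : (1 < q)%N) (n_gt0 : (0 < n)%N).
Hypotheses (cardE : #|E| = (q ^ n)%N) (cardC : #|C| = n).
Hypothesis cosetC : forall A, A \in C ->
  exists (u : E) (H : {group E}), #|H| = (q ^ n.-1)%N /\ A = (u *: H)%g.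
Hypothesis card_capC : forall D : {set {set E}},
  D \subset C -> #|\bigcap_(A in D) A| = (q ^ (n - #|D|))%N.
Let S := \bigcap_(A in C) ~: A.
Let m := (q ^ n).-1.

Lemma avoiding_weight_norm :
  fnorm (fun x : E => (x \in S)%:R) <= (2 * (1 - q%:R^-1)) ^+ n.
Proof.
have nz_q : q%:R != 0 :> algC by rewrite pnatr_eq0 -lt0n ltnW.
have abE : abelian [set: E] by apply: zmod_abelian.
rewrite (@eq_fnorm _ _ (fun x => \prod_(A <- enum C) (x \notin A)%:R)); last first.
  move=> x; rewrite big_enum /=; have [/bigcapP in_all | ] := boolP (x \in S).
    by rewrite big1 // => A /in_all; rewrite inE => ->.
  move=> notin; have [A CA Ax] : exists2 A, A \in C & x \in A.
    apply/exists_inP; apply: contraR notin; rewrite negb_exists_in.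
    by move/forall_inP=> in_all; apply/bigcapP=> A CA; rewrite inE in_all.
  by rewrite (bigD1 A) //= Ax mul0r.
apply: le_trans (fnorm_prod abE _ _) _.
rewrite -cardC -prodr_const -big_enum /=.
rewrite big_seq [leRHS]big_seq.
apply: ler_prod => A; rewrite mem_enum => CA; rewrite fnorm_ge0 /=.
have [u [H [cardH ->]]] := cosetC CA.
apply: le_trans (fnorm_coset_compl abE _ _) _.
rewrite cardsT cardE cardH -[in X in _ / X](prednK n_gt0) expnS.
by rewrite natrM invfM mulrCA divff ?mulr1 // natrX expf_neq0.
Qed.

Let card_unit : #|[set: {unit E}]| = m.
Proof. by rewrite card_finField_unit cardE. Qed.

Lemma generator_avoiding_by_count :
  (q ^ n < totient m + (q - 1) ^ n)%N ->
  exists2 u : {unit E}, generator [set: {unit E}] u & val u \in S.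
Proof.
have [g gen_g] := cyclicP (unit_cyclic E).
pose P := [set val u | u in [set u | generator [set: {unit E}] u]].
have cardP : #|P| = totient m.
  rewrite card_imset; last exact: val_inj.
  by rewrite gen_g -totient_gen /order -gen_g card_unit.
have cardS : #|S| = ((q - 1) ^ n)%N.
  apply/eqP; rewrite -(eqr_nat algC) (card_bigcap_setC cardC card_capC).
  by rewrite natrX natrB // ltnW.
rewrite -cardP -cardS => big_sum.
have : (0 < #|P :&: S|)%N.
  have := max_card (mem (P :|: S)).
  rewrite cardE => leU.
  by rewrite -(ltn_add2l #|P :|: S|) cardsUI addn0 (leq_ltn_trans leU).
rewrite card_gt0 => /set0Pn[x /setIP[/imsetP[u]]]; rewrite inE => gen_u -> Su.
by exists u.
Qed.

(** Suppose there is no such u. Then the weighted sum vanishes, and [fourier_sum_bound] bounds the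
    number N of units in S from above. With s = q^(n/2) and a = (q - 1)^n, this and N >= a - 1 give
    2^n a <= s, whereas s^2 <= 2^n a and s > 1. *)
Lemma generator_avoiding_by_sum :
  (4 ^ (size (primes m) + n) <= q ^ n)%N ->
  exists2 u : {unit E}, generator [set: {unit E}] u & val u \in S.
Proof.
move=> le_q; have [g gen_g] := cyclicP (unit_cyclic E).
pose w := @gen_weight {unit E}; pose f x : algC := (x \in S)%:R.
have [/existsP[u /andP[Su gen_u]] | none] :=
  boolP [exists u, (val u \in S) && generator [set: {unit E}] u].
  by exists u.
have sum0 : \sum_u f (val u) * w u = 0.
  apply: big1 => u _; rewrite /f /w /gen_weight -natrM mulnb.
  by move: none; rewrite negb_exists => /forallP/(_ u)/negPf->.
have := fourier_sum_bound f w; rewrite sum0 sub0r normrN normrM.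
have w0 := gen_weight_coef0 gen_g; rewrite -/w card_unit in w0.
have w1 := gen_weight_norm gen_g; rewrite -/w card_unit -w0 in w1.
have w0_gt0 : 0 < fcoef w 0.
  by rewrite w0 divr_gt0 ?ltr0n ?totient_gt0 -?card_unit ?cardG_gt0.
rewrite (gtr0_norm w0_gt0) cardE.
set s := sqrtC _; set k := size (primes m) in w1 le_q.
set N := \sum_(u : {unit E}) f (val u) => bound.
have s_ge0 : 0 <= s by rewrite sqrtC_ge0 ler0n.
have s2 : s ^+ 2 = q%:R ^+ n by rewrite sqrtCK natrX.
have s_gt1 : 1 < s.
  rewrite -(ltr_pXn2r (n := 2)) ?nnegrE // expr1n s2 exprn_egt1 ?ltr1n //.
  by rewrite -lt0n.
have le_s : 2 ^+ k * 2 ^+ n <= s :> algC.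
  rewrite -exprD -(ler_pXn2r (n := 2)) ?nnegrE ?exprn_ge0 // s2.
  by rewrite -exprM mulnC exprM -!natrX ler_nat.
have q1_ge0 : 0 <= q%:R - 1 :> algC by rewrite subr_ge0 ler1n ltnW.
have nz_q : q%:R != 0 :> algC by rewrite pnatr_eq0 -lt0n ltnW.
(* The loss of 1 allows for 0, which may lie in S but is not a unit. *)
have N_ge : (q%:R - 1) ^+ n - 1 <= N.
  rewrite -(card_bigcap_setC cardC card_capC) -/S lerBlDr /N.
  have -> : \sum_(u : {unit E}) f (val u)
            = #|[set val u | u in [set u : {unit E} | val u \in S]]|%:R.
    rewrite card_imset; last exact: val_inj.
    rewrite -sum1_card natr_sum [RHS]big_mkcond; apply: eq_bigr => u _.
    by rewrite inE /f; case: (_ \in S).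
  rewrite natr1 ler_nat (cardsD1 0) -add1n leq_add ?leq_b1 //.
  apply/subset_leq_card/subsetP=> x /setD1P[nz_x Sx].
  have Ux : x \is a GRing.unit by rewrite unitfE.
  by apply/imsetP; exists (FinRing.unit E Ux) => //; rewrite inE.
have N_ge0 : 0 <= N by apply: sumr_ge0 => u _; apply: ler0n.
have N_le : N <= (2 ^+ k - 1) * ((2 * (1 - q%:R^-1)) ^+ n * s).
  rewrite -(ler_pM2l w0_gt0) -[X in _ * X <= _](ger0_norm N_ge0).
  apply: le_trans bound _; rewrite [leRHS]mulrA ler_pM //.
  - by rewrite subr_ge0 /fnorm (bigD1 0) //= gtr0_norm // lerDl sumr_ge0.
  - by rewrite mulr_ge0 ?fnorm_ge0.
  - by rewrite mulrBr mulr1 lerB // mulrC.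
  by rewrite ler_wpM2r // avoiding_weight_norm.
have s_gt0 : 0 < s by apply: lt_trans s_gt1.
pose a : algC := (q%:R - 1) ^+ n.
have a_ge0 : 0 <= a by rewrite exprn_ge0.
(* The bounds on N read (a - 1) s <= (2^k - 1) 2^n a, and 2^k 2^n <= s. *)
have le_a : 2 ^+ n * a <= s.
  have := le_trans N_ge N_le; rewrite -/a.
  have -> : (2 * (1 - q%:R^-1)) ^+ n * s = 2 ^+ n * a / s :> algC.
    have -> : 1 - q%:R^-1 = (q%:R - 1) / q%:R :> algC by rewrite mulrBl divff ?mul1r.
    rewrite !exprMn exprVn -s2 expr2 invfM -/a -!mulrA mulVf ?mulr1 //.
    by rewrite gt_eqF.
  rewrite mulrA ler_pdivlMr // mulrBl mul1r lerBlDr => le_as.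
  rewrite -(lerD2l (a * s)); apply: le_trans (_ : 2 ^+ k * 2 ^+ n * a + s <= _).
    rewrite -lerBrDr -addrA [_ + - _]addrC addrA.
    by apply: le_trans le_as _; rewrite mulrBl mul1r !mulrA addrAC.
  by rewrite lerD2r [leRHS]mulrC ler_wpM2r.
(* This is q <= 2 (q - 1) raised to the power n. *)
have le_q2 : s ^+ 2 <= 2 ^+ n * a.
  rewrite s2 -exprMn ler_pXn2r ?nnegrE ?mulr_ge0 ?ler0n //.
  by rewrite mulrBr mulr1 mulr_natl mulr2n -addrA lerDl subr_ge0 ler_nat.
have := le_trans le_q2 le_a; rewrite expr2 ger_pMl // => le_s1.
by have := lt_le_trans s_gt1 le_s1; rewrite ltxx.
Qed.

End AvoidingCosets.

(** * From affine spaces to cosets, and the theorem *)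

Section Avoiding.
Variables (F : finFieldType) (L : fieldExtType F).
Local Notation n := (\dim {: L}).

Let E : finFieldType := finvect_type L.

Lemma card_affine_space t (A : {set finvect_type L}) :
  affine_space t A -> #|A| = (#|F| ^ t)%N.
Proof.
move=> [u [V [dimV ->]]]; rewrite card_imset ?card_vspace ?dimV //.
exact: addrI.
Qed.

(** The group law of E in [group_scope] is addition, so u + V is literally a left coset. *)
Lemma affine_space_coset t (A : {set finvect_type L}) : affine_space t A ->
  exists (u : E) (H : {group E}), #|H| = (#|F| ^ t)%N /\ A = (u *: H)%g.
Proof.
move=> [u [V [dimV ->]]].
have gV : group_set ([set v in V] : {set E}).
  by apply/group_setP; split=> [|x y]; rewrite !inE ?mem0v // => ? ?; apply: memvD.
exists u, (Group gV); split; first by rewrite /= cardsE card_vspace dimV.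
have memH (v x : E) : (x \in (v *: Group gV)%g) = (- v + x \in V).
  by rewrite mem_lcoset /= inE.
apply/setP=> x; rewrite memH; apply/imsetP/idP => [[v Vv ->] | Vx].
  by rewrite addKr.
by exists (- u + x) => //; rewrite addNKr.
Qed.

Lemma card_finvect : #|finvect_type L| = (#|F| ^ n)%N.
Proof. by rewrite -[RHS](card_vspace (fullv : {vspace finvect_type L})) card_vspacef. Qed.

Lemma primitive_avoiding (C : {set {set finvect_type L}}) (q := #|F|) (m := (q ^ n).-1) :
  (1 < n)%N -> #|C| = n -> (forall A, A \in C -> affine_hyperplane A) ->
  general_position C ->
  (4 ^ (size (primes m) + n) <= q ^ n)%N \/ (q ^ n < totient m + (q - 1) ^ n)%N ->
  exists x, x \in avoiding C /\ primitive_element x.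
Proof.
move=> n_gt1 cardC hyperC genC crit.
have n_gt0 := ltnW n_gt1; have q_gt1 : (1 < q)%N := finNzRing_gt1 F.
have capC (D : {set {set E}}) : D \subset C -> #|\bigcap_(A in D) A| = (q ^ (n - #|D|))%N.
  (* General position speaks only of nonempty D; the empty intersection is the whole field, of
     cardinality q^n. *)
  move=> sDC; have [->|nzD] := eqVneq D set0.
    by rewrite big_set0 cards0 subn0 cardsT card_finvect.
  apply: card_affine_space; apply: genC => //.
  by rewrite card_gt0 nzD -cardC subset_leq_card.
have cosetC A : A \in C -> exists (u : E) (H : {group E}), #|H| = (q ^ n.-1)%N /\ A = (u *: H)%g.
  by move=> CA; apply: affine_space_coset (hyperC A CA).
have [u gen_u Su] : exists2 u : {unit E}, generator [set: {unit E}] u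
                                        & val u \in \bigcap_(A in C) ~: A.
  case: crit => [le_q | lt_q].
    exact: generator_avoiding_by_sum q_gt1 n_gt0 card_finvect cardC cosetC capC le_q.
  exact: generator_avoiding_by_count q_gt1 card_finvect cardC capC lt_q.
by exists (val u); split=> //; exists u.
Qed.

End Avoiding.

Local Close Scope ring_scope.
Local Close Scope group_scope.

Theorem theorem1p1 :
  exists N : nat -> nat,
  forall (q n : nat) (F : finFieldType) (L : fieldExtType F)
         (C : {set {set finvect_type L}}),
    #|F| = q -> \dim {: L} = n -> 2 <= n ->
    #|C| = n ->
    (forall A : {set finvect_type L}, A \in C -> affine_hyperplane A) ->
    general_position C ->
    [\/ 16 <= q,
        q = 13 /\ n <> 4,
        q = 11 /\ n \notin [:: 4; 6; 12]
      | q \in [:: 7; 8; 9] /\ N q <= n] ->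
    exists x : finvect_type L, x \in avoiding C /\ primitive_element x.
Proof.
have [N crit789] := criterion_7_8_9; exists N.
move=> q n F L C <- <- n_ge2 cardC hyperC genC hq.
apply: primitive_avoiding => //; apply/orP; rewrite -/(criterion _ _).
case: hq => [q_ge16 | [-> n_neq] | [-> n_notin] | [q_in n_ge]].
- exact: criterion_ge16.
- exact: criterion13.
- exact: criterion11.
exact: crit789.
Qed.
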